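(* Let $A\in\mathbb{R}^{n\times n}$, let the vector norm be the Euclidean norm, and let $j\in\{1,\dots,q\}$ be such that $\Lambda_j$ is single complex. The $\frac{\pi}{\omega_j}$-periodic function $t\mapsto\|\widehat\Theta_j(t)\|_2$ oscillates monotonically between the extreme values $$\max_{t\in\mathbb{R}}\|\widehat\Theta_j(t)\|_2=\sqrt{\frac{(1+V_j)(1+W_j)}{4}}\quad\text{and}\quad\min_{t\in\mathbb{R}}\|\widehat\Theta_j(t)\|_2=\sqrt{\frac{a_{V_jW_j}}{4}},$$ where $$a_{V_jW_j}:=\begin{cases}(1-V_j)(1+W_j)&\text{if }V_j\le W_j,\\(1+V_j)(1-W_j)&\text{if }V_j\ge W_j.\end{cases}$$ The maximum value is achieved if $\Omega_j(t)$ is an even multiple of $\pi$ and the minimum value is achieved if $\Omega_j(t)$ is an odd multiple of $\pi$.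
   Context: The spectrum of $A$ is partitioned by real parts into $\Lambda_1,\dots,\Lambda_q$, where $\Lambda_j$ contains all eigenvalues with real part $r_j$ and $r_1>\dots>r_q$. $\Lambda_j$ is single complex if it consists of a complex conjugate pair $\lambda_j,\overline{\lambda_j}$ of non-real eigenvalues, each having exactly one Jordan block of maximum order; $\lambda_j$ is the one with positive imaginary part $\omega_j>0$. Let $V$ be an invertible matrix whose columns form a Jordan basis for $A$ and $W=V^{-1}$. Let $v^{(j,1)},\dots,v^{(j,M_j)}$ (columns of $V$) be the unique longest Jordan chain for $\lambda_j$, with $v^{(j,1)}$ an eigenvector; put $v^{(j)}:=v^{(j,1)}$ and let $w^{(j)}$ be the row of $W$ whose index equals the column index of $v^{(j,M_j)}$ in $V$. The basis is chosen so that $\overline{v^{(j,1)}},\dots,\overline{v^{(j,M_j)}}$ are columns of $V$ forming the longest Jordan chain for $\overline{\lambda_j}$ and the row of $W$ corresponding to $\overline{v^{(j,M_j)}}$ is $\overline{w^{(j)}}$. Put $\widehat v^{(j)}:=v^{(j)}/\|v^{(j)}\|_2$, $\widehat w^{(j)}:=w^{(j)}/\|w^{(j)}\|_2$. Polar forms: $\widehat v^{(j)}_k=|\widehat v^{(j)}_k|\mathrm{e}^{\mathrm{i}\alpha_{jk}}$, $\widehat w^{(j)}_l=|\widehat w^{(j)}_l|\mathrm{e}^{\mathrm{i}\beta_{jl}}$, $(\widehat v^{(j)})^T\widehat v^{(j)}=V_j\mathrm{e}^{\mathrm{i}\delta_j}$ with $V_j\ge0$; $W_j:=|\widehat w^{(j)}(\widehat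 w^{(j)})^T|$ (transposes without conjugation; angle of $0$ is any fixed real number). One has $V_j,W_j\in[0,1)$. $\widehat\Theta_j(t):=\big[|\widehat v^{(j)}_k||\widehat w^{(j)}_l|\cos(\omega_jt+\alpha_{jk}+\beta_{jl})\big]_{k,l=1,\dots,n}\in\mathbb{R}^{n\times n}$, and $\|\widehat\Theta_j(t)\|_2$ is its spectral norm. Let $R_j\in\mathbb{R}^{2\times n}$ have rows $\mathrm{Re}(\widehat w^{(j)})$ and $\mathrm{Im}(\widehat w^{(j)})$ and let $\alpha^{(j)}\in\mathbb{R}^2$ be a unit left singular vector of $R_j$ for its largest singular value; $\theta_j$ is the angle between the real axis and $\alpha^{(j)}$ (identifying $\mathbb{R}^2$ with $\mathbb{C}$). Then $\Omega_j(t):=2(\omega_jt+\theta_j)+\delta_j$. ''Oscillates monotonically between its extreme values'' means: on each closed interval whose endpoints are two consecutive points among those listed as achieving the maximum and the minimum, the function is monotone (not necessarily strictly), going from the maximum value to the minimum value or vice versa. *)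

(* Defs.v *)
(* MathComp / MathComp-Analysis, with R[i] from mathcomp-real-closed. *)
From HB Require Import structures.
From mathcomp Require Import all_boot all_order all_algebra.
From mathcomp Require Import all_classical all_reals all_analysis.
From mathcomp Require Export complex.
Set Implicit Arguments.
Unset Strict Implicit.
Unset Printing Implicit Defensive.
Import Order.TTheory GRing.Theory Num.Theory.
Import numFieldNormedType.Exports.
Local Open Scope classical_set_scope.
Local Open Scope ring_scope.
Local Open Scope complex_scope.

Section Norms.
Variable R : realType.

Definition modulus (z : R[i]) : R := ComplexField.Normc.normc z.

Definition expi (a : R) : R[i] := cos a +i* sin a.

(* [a] is an angle of [z]; every real number is an angle of [0]. *)
Definition is_angle (a : R) (z : R[i]) : Prop := z = (modulus z)%:C * expi a.

Definition norm2 n (x : 'cV[R]_n) : R := Num.sqrt (\sum_i x i 0 ^+ 2).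

(* Euclidean norm of a complex row or column vector. *)
Definition cnorm2 m n (v : 'M[R[i]]_(m, n)) : R :=
  Num.sqrt (\sum_i \sum_k modulus (v i k) ^+ 2).

Definition normalize m n (v : 'M[R[i]]_(m, n)) : 'M[R[i]]_(m, n) :=
  ((cnorm2 v)^-1)%:C *: v.

Definition spectral_norm m n (M : 'M[R]_(m, n)) : R :=
  sup [set norm2 (M *m x) | x in [set x : 'cV[R]_n | norm2 x = 1]].

Definition singular_triple m n (M : 'M[R]_(m, n))
    (s : R) (u : 'cV[R]_m) (v : 'cV[R]_n) : Prop :=
  [/\ 0 <= s, norm2 u = 1, norm2 v = 1, M *m v = s *: u & M^T *m u = s *: v].

Definition top_left_singular_vector m n (M : 'M[R]_(m, n))
    (u : 'cV[R]_m) : Prop :=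
  exists s v, singular_triple M s u v /\
    forall s' u' v', singular_triple M s' u' v' -> s' <= s.

End Norms.

Section Jordan.
Variables (R : realType) (n : nat).
Implicit Types (A : 'M[R]_n) (V : 'M[R[i]]_n).

Definition complexify A : 'M[R[i]]_n := map_mx (real_complex R) A.

(* A Jordan chain taken from the columns of a matrix: its eigenvalue, the index
   of the column holding the eigenvector, and the indices of the columns holding
   the successive generalized eigenvectors. *)
Definition chain : Type := (R[i] * 'I_n * seq 'I_n)%type.
Definition chain_eigenvalue (c : chain) : R[i] := c.1.1.
Definition chain_columns (c : chain) : seq 'I_n := c.1.2 :: c.2.
Definition chain_first (c : chain) : 'I_n := c.1.2.
Definition chain_last (c : chain) : 'I_n := last c.1.2 c.2.
Definition chain_length (c : chain) : nat := size (chain_columns c).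

Definition is_jordan_chain A V (c : chain) : Prop :=
  let z := chain_eigenvalue c in
  complexify A *m col (chain_first c) V = z *: col (chain_first c) V /\
  path (fun i k => complexify A *m col k V == z *: col k V + col i V)
       (chain_first c) c.2.

(* The columns of [V] form a Jordan basis, [cs] being its Jordan chains; these
   correspond to the Jordan blocks, the length of a chain being the order of
   its block. *)
Definition jordan_basis A V (cs : seq chain) : Prop :=
  [/\ V \in unitmx,
      perm_eq (flatten [seq chain_columns c | c <- cs]) (enum 'I_n) &
      forall c, c \in cs -> is_jordan_chain A V c].

Definition max_order (cs : seq chain) (z : R[i]) : nat :=
  \max_(c <- cs | chain_eigenvalue c == z) chain_length c.

(* The list of eigenvalues and orders of the blocks is the same for all Jordan
   bases, so that it does not matter which one is used. *)
Definition one_block_of_max_order A (z : R[i]) : Prop :=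
  exists V cs, jordan_basis A V cs /\
    count (fun c => (chain_eigenvalue c == z) &&
                    (chain_length c == max_order cs z)) cs = 1%N.

Definition longest_chain (cs : seq chain) (z : R[i]) (c : chain) : Prop :=
  [/\ c \in cs, chain_eigenvalue c = z & chain_length c = max_order cs z].

(* [r 0 > r 1 > ...] are the distinct real parts of the eigenvalues. *)
Definition spectral_real_parts A q (r : 'I_q -> R) : Prop :=
  (forall i k : 'I_q, (i < k)%N -> r k < r i) /\
  (forall x, (exists i, r i = x) <->
             (exists2 z, eigenvalue (complexify A) z & complex.Re z = x)).

Definition eigenvalues_of_real_part A (x : R) : set R[i] :=
  [set z | eigenvalue (complexify A) z /\ complex.Re z = x].

(* The set of the eigenvalues with real part [x] is single complex; [z] is its
   element with positive imaginary part. *)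
Definition single_complex A (x : R) (z : R[i]) : Prop :=
  [/\ eigenvalues_of_real_part A x = [set z; (conjc z)], 0 < complex.Im z,
      one_block_of_max_order A z & one_block_of_max_order A (conjc z)].

Definition conjugate_chains V (c c' : chain) : Prop :=
  [seq col k V | k <- chain_columns c'] =
    [seq map_mx conjc (col k V) | k <- chain_columns c] /\
  row (chain_last c') (invmx V) =
    map_mx conjc (row (chain_last c) (invmx V)).

End Jordan.

Section Oscillation.
Variables (R : realType) (n : nat).

Definition Theta (v : 'cV[R[i]]_n) (w : 'rV[R[i]]_n) (omega : R)
    (alpha beta : 'I_n -> R) (t : R) : 'M[R]_n :=
  \matrix_(k, l) (modulus (v k 0) * modulus (w 0 l) *
                  cos (omega * t + alpha k + beta l)).

Definition re_im_rows (w : 'rV[R[i]]_n) : 'M[R]_(2, n) :=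
  \matrix_(i, l) if i == 0 then complex.Re (w 0 l) else complex.Im (w 0 l).

Definition is_maximum (f : R -> R) (M : R) : Prop :=
  (exists t, f t = M) /\ forall t, f t <= M.

Definition is_minimum (f : R -> R) (m : R) : Prop :=
  (exists t, f t = m) /\ forall t, m <= f t.

Definition consecutive (E : set R) (a b : R) : Prop :=
  [/\ a < b, E a, E b & forall t, a < t -> t < b -> ~ E t].

(* [E] is the set of the points listed as achieving the extreme values. *)
Definition oscillates_monotonically (f : R -> R) (M m : R) (E : set R) : Prop :=
  forall a b, consecutive E a b ->
    [/\ f a = M, f b = m &
        forall s t, a <= s -> s <= t -> t <= b -> f t <= f s] \/
    [/\ f a = m, f b = M &
        forall s t, a <= s -> s <= t -> t <= b -> f s <= f t].

Definition even_multiple_pi (x : R) : Prop :=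
  exists k : int, x = (2 * k)%:~R * pi.

Definition odd_multiple_pi (x : R) : Prop :=
  exists k : int, x = (2 * k + 1)%:~R * pi.

(* Both cases agree when [v = w]. *)
Definition amin (v w : R) : R :=
  if v <= w then (1 - v) * (1 + w) else (1 + v) * (1 - w).

End Oscillation.

(* Main.v *)
(* Rotating [w] by [exp (- i theta)] makes [w w^T] a nonnegative real number, so that
   the real and imaginary parts [a], [b] of the rotated [w] are orthogonal with
   [|a|^2 = (1 + W) / 2] and [|b|^2 = (1 - W) / 2]. With [p + i q] the vector [v]
   rotated by [exp (i (omega t + theta))], [Theta t = p a - q b], and the Gram matrix
   of [p], [q] is determined by [V] and [Omega t]. The squared spectral norm is
   therefore the larger root of [l^2 - T l + D] with
   [T = (1 + V W cos (Omega t)) / 2] and [D = (1 - V^2) (1 - W^2) / 16], which is a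
   nondecreasing function of [cos (Omega t)]. *)
Require Import Defs.
From HB Require Import structures.
From mathcomp Require Import all_boot all_order all_algebra.
From mathcomp Require Import all_classical all_reals all_analysis.
From mathcomp Require Import complex.
From mathcomp Require Import ring lra.
Set Implicit Arguments.
Unset Strict Implicit.
Unset Printing Implicit Defensive.
Import Order.TTheory GRing.Theory Num.Theory.
Import numFieldNormedType.Exports.
Local Open Scope classical_set_scope.
Local Open Scope ring_scope.
Local Open Scope complex_scope.

(** * Spectral norms of real matrices of rank at most two *)

Section SpectralNorm.
Variable R : realType.

Lemma sum_sqr_lincomb (I : finType) (s t : R) (f g : I -> R) :
  \sum_i (s * f i + t * g i) ^+ 2 =
  s ^+ 2 * (\sum_i f i ^+ 2) + 2 * s * t * (\sum_i f i * g i) +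
  t ^+ 2 * (\sum_i g i ^+ 2).
Proof.
rewrite !mulr_sumr -!big_split /=; apply: eq_bigr => i _; ring.
Qed.

Lemma norm2_eq1 n (x : 'cV[R]_n) :
  norm2 x = 1 <-> \sum_i x i 0 ^+ 2 = 1.
Proof.
have x0 : 0 <= \sum_i x i 0 ^+ 2 by apply: sumr_ge0 => i _; rewrite sqr_ge0.
by split => [h|h]; [rewrite -(sqr_sqrtr x0) -/(norm2 x) h expr1n|
  rewrite /norm2 h sqrtr1].
Qed.

Lemma norm2_scale n (k : R) (x : 'cV[R]_n) :
  0 <= k -> norm2 (k *: x) = k * norm2 x.
Proof.
move=> k0; rewrite /norm2; under eq_bigr do rewrite mxE exprMn.
by rewrite -mulr_sumr sqrtrM ?sqr_ge0// sqrtr_sqr ger0_norm.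
Qed.

(* Homogeneity lets the maximizing vector [x] be any nonzero vector. *)
Lemma spectral_norm_eq_sqrt m n (M : 'M[R]_(m, n)) (l : R) :
  (forall x : 'cV_n, \sum_i (M *m x) i 0 ^+ 2 <= l * \sum_i x i 0 ^+ 2) ->
  (exists2 x : 'cV_n, 0 < \sum_i x i 0 ^+ 2 &
    \sum_i (M *m x) i 0 ^+ 2 = l * \sum_i x i 0 ^+ 2) ->
  spectral_norm M = Num.sqrt l.
Proof.
move=> le [x x0 eqx].
rewrite /spectral_norm; set S := (X in sup X).
have ubS : ubound S (Num.sqrt l).
  move=> _ [y /norm2_eq1 y1 <-].
  by rewrite ler_wsqrtr// (le_trans (le y))// y1 mulr1.
have lS : S (Num.sqrt l).
  have nx0 : 0 < norm2 x by rewrite sqrtr_gt0.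
  exists ((norm2 x)^-1 *: x) => /=.
    by rewrite norm2_scale ?invr_ge0 ?ltW// mulVf// gt_eqF.
  rewrite -scalemxAr norm2_scale ?invr_ge0 ?ltW// [norm2 (M *m x)]/norm2 eqx [l * _]mulrC.
  by rewrite sqrtrM ?ltW// -/(norm2 x) mulKf// gt_eqF.
apply/eqP; rewrite eq_le; apply/andP; split.
  by apply: ge_sup => //; exists (Num.sqrt l).
by apply: ub_le_sup => //; exists (Num.sqrt l).
Qed.

(** The minus sign makes the entries the real parts of [(p k + i q k) * (a l + i b l)], the form in
    which [Theta] arises. *)
Definition rank_two m n (p q : 'I_m -> R) (a b : 'I_n -> R) : 'M[R]_(m, n) :=
  \matrix_(k, l) (p k * a l - q k * b l).

Lemma sum_sqr_rank_two m n (p q : 'I_m -> R) (a b : 'I_n -> R) (x : 'cV[R]_n) :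
  let y := \sum_l a l * x l 0 in let z := \sum_l b l * x l 0 in
  \sum_k (rank_two p q a b *m x) k 0 ^+ 2 =
  y ^+ 2 * (\sum_k p k ^+ 2) - 2 * y * z * (\sum_k p k * q k) +
  z ^+ 2 * (\sum_k q k ^+ 2).
Proof.
move=> y z; transitivity (\sum_k (y * p k + - z * q k) ^+ 2).
  apply: eq_bigr => k _; congr (_ ^+ 2); rewrite mxE /y /z mulNr !mulr_suml.
  by rewrite -sumrB; apply: eq_bigr => l _; rewrite mxE; ring.
by rewrite sum_sqr_lincomb; ring.
Qed.

(* By orthogonality of [a] and [b] the coordinates [y = a x], [z = b x] of a unit
   vector [x] fill the ellipse [y^2/|a|^2 + z^2/|b|^2 <= 1]; the squared norm of
   the image is the quadratic form of the Gram matrix of [p] and [-q] in [(y, z)],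
   so its maximum [l] is the larger root of the characteristic polynomial of the
   product of the two Gram matrices. *)
Lemma spectral_norm_rank_two m n (p q : 'I_m -> R) (a b : 'I_n -> R) (l : R) :
  let P := \sum_k p k ^+ 2 in let Q := \sum_k q k ^+ 2 in
  let N := \sum_k p k * q k in
  let A := \sum_k a k ^+ 2 in let B := \sum_k b k ^+ 2 in
  \sum_k a k * b k = 0 -> 0 < A -> P * A <= l -> Q * B <= l ->
  (l - P * A) * (l - Q * B) = A * B * N ^+ 2 ->
  spectral_norm (rank_two p q a b) = Num.sqrt l.
Proof.
move=> P Q N A B ab0 A0 PAl QBl charl.
have P0 : 0 <= P by apply: sumr_ge0 => i _; rewrite sqr_ge0.
have l0 : 0 <= l by rewrite (le_trans _ PAl)// mulr_ge0// ltW.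
have B0 : 0 <= B by apply: sumr_ge0 => i _; rewrite sqr_ge0.
have ba0 : \sum_k b k * a k = 0 by under eq_bigr do rewrite mulrC.
pose x_ (s t : R) : 'cV[R]_n := \col_i (s * a i + t * b i).
have x_sqr s t : \sum_i x_ s t i 0 ^+ 2 = s ^+ 2 * A + t ^+ 2 * B.
  by under eq_bigr do rewrite mxE; rewrite sum_sqr_lincomb ab0 -/A -/B; ring.
have x_img s t : \sum_k (rank_two p q a b *m x_ s t) k 0 ^+ 2 =
    (s * A) ^+ 2 * P - 2 * (s * A) * (t * B) * N + (t * B) ^+ 2 * Q.
  rewrite sum_sqr_rank_two -/P -/Q -/N.
  have -> : \sum_i a i * x_ s t i 0 = s * A + t * \sum_k a k * b k.
    by rewrite /A /B !mulr_sumr -big_split; apply: eq_bigr => i _; rewrite mxE /=; ring.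
  have -> : \sum_i b i * x_ s t i 0 = s * (\sum_k b k * a k) + t * B.
    by rewrite /A /B !mulr_sumr -big_split; apply: eq_bigr => i _; rewrite mxE /=; ring.
  by rewrite ab0 ba0 !mulr0 addr0 add0r.
(* If [B = 0], the second semi-axis degenerates and the division by [B] below is meaningless; but
   then [b = 0], the matrix has rank at most one, and Cauchy-Schwarz suffices. *)
have [B_eq0|B_neq0] := eqVneq B 0.
  have b0 k : b k = 0.
    move/eqP: B_eq0; rewrite psumr_eq0; last by move=> i _; rewrite sqr_ge0.
    by move/allP/(_ k); rewrite mem_index_enum sqrf_eq0 => /(_ isT)/eqP.
  have lE : l = P * A.
    move: charl QBl; rewrite B_eq0 !mulr0 mul0r subr0 => /eqP.
    rewrite mulf_eq0 subr_eq0 => /orP[/eqP//|/eqP lz _].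
    by apply/eqP; rewrite eq_le PAl lz mulr_ge0// ltW.
  apply: spectral_norm_eq_sqrt => [x|]; last first.
    by exists (x_ 1 0); rewrite ?x_img x_sqr ?lE; [nra|ring].
  rewrite sum_sqr_rank_two -/P -/Q -/N (_ : \sum_l b l * x l 0 = 0); last first.
    by rewrite big1// => k _; rewrite b0 mul0r.
  set y := \sum_l _.
  (* Cauchy-Schwarz: the squared norm of [A x - y a] equals [A * (A * X - y ^+ 2)]. *)
  have := sum_sqr_lincomb A (- y) (fun i => x i 0) a.
  rewrite -/A (_ : \sum_i x i 0 * a i = y); last by apply: eq_bigr => k _; rewrite mulrC.
  set X := \sum_i x i 0 ^+ 2 => E.
  have : 0 <= A * (A * X - y ^+ 2).
    rewrite (_ : _ * _ = A ^+ 2 * X + 2 * A * - y * y + (- y) ^+ 2 * A); last by ring.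
    by rewrite -E; apply: sumr_ge0 => i _; rewrite sqr_ge0.
  rewrite pmulr_rge0// => /(mulr_ge0 P0); rewrite lE -/X; lra.
have {B0 B_neq0} B0 : 0 < B by rewrite lt_neqAle eq_sym B_neq0.
apply: spectral_norm_eq_sqrt => [x|].
  rewrite sum_sqr_rank_two -/P -/Q -/N; set y := \sum_l _; set z := \sum_l _.
  set X := \sum_i x i 0 ^+ 2.
  (* Bessel's inequality: subtract from [x] its projection [(y / A) a + (z / B) b] on the span of
     [a] and [b]. *)
  have bessel : y ^+ 2 / A + z ^+ 2 / B <= X.
    have : 0 <= \sum_i (1 * x i 0 + (-1) * (y / A * a i + z / B * b i)) ^+ 2.
      by apply: sumr_ge0 => i _; rewrite sqr_ge0.
    rewrite sum_sqr_lincomb (sum_sqr_lincomb (y / A) (z / B)) ab0.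
    rewrite (_ : \sum_i x i 0 * _ = y / A * y + z / B * z); last first.
      by rewrite /y /z !mulr_sumr -big_split; apply: eq_bigr => i _ /=; ring.
    rewrite -/A -/B -/X; set e := (X in 0 <= X -> _).
    rewrite (_ : e = X - (y ^+ 2 / A + z ^+ 2 / B)) ?subr_ge0// /e; field.
    by rewrite !gt_eqF.
  apply: (le_trans _ (ler_wpM2l l0 bessel)).
  have [AV BV] : 0 < A^-1 /\ 0 < B^-1 by rewrite !invr_gt0.
  (* The difference to be shown nonnegative is a quadratic form in [(y, z)] with diagonal
     coefficients [c], [d] and off-diagonal coefficient [N]. The characteristic equation says that
     its determinant [c * d - N ^+ 2] vanishes, so [c] times the form is a perfect square. *)
  pose c := l / A - P; pose d := l / B - Q.
  have c0 : 0 <= c by rewrite subr_ge0 ler_pdivlMr.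
  have d0 : 0 <= d by rewrite subr_ge0 ler_pdivlMr.
  have cd : c * d = N ^+ 2.
    apply: (mulfI (lt0r_neq0 A0)); apply: (mulfI (lt0r_neq0 B0)).
    rewrite [RHS]mulrA [B * A]mulrC -charl /c /d; field.
    by rewrite !gt_eqF.
  rewrite -subr_ge0 (_ : _ - _ = c * y ^+ 2 + 2 * N * (y * z) + d * z ^+ 2); last first.
    by rewrite /c /d; field; rewrite !gt_eqF.
  have [cE|cN] := eqVneq c 0.
    have N0 : N = 0 by apply/eqP; rewrite -sqrf_eq0 -cd cE mul0r.
    by rewrite N0 cE; nra.
  have cp : 0 < c by rewrite lt_neqAle eq_sym cN.
  rewrite -(pmulr_rge0 _ cp); set e := (X in 0 <= X).
  rewrite (_ : e = (c * y + N * z) ^+ 2) ?sqr_ge0//.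
  by transitivity (c ^+ 2 * y ^+ 2 + 2 * c * N * y * z + (c * d) * z ^+ 2);
    [rewrite /e|rewrite cd]; ring.
(* If [l = Q * B], the general witness below may vanish; here [N = 0], and [b] itself attains the
   bound. *)
have [lE|lN] := eqVneq l (Q * B).
  have N0 : N = 0.
    move/eqP: charl; rewrite {2}lE subrr mulr0 eq_sym !mulf_eq0 orbb.
    by rewrite (gt_eqF A0) (gt_eqF B0) => /eqP.
  exists (x_ 0 1); rewrite ?x_img x_sqr; first by nra.
  by rewrite N0 lE; ring.
have lp : 0 < l - Q * B by rewrite subr_gt0 lt_neqAle QBl eq_sym lN.
(* In the coordinates [y = s * A], [z = t * B] this vector solves [N * y + d * z = 0] with
   [d = l / B - Q], so it spans the kernel of the degenerate form above. *)
exists (x_ (l - Q * B) (- (A * N))); rewrite ?x_img x_sqr.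
  by apply: ltr_pwDl; [rewrite mulr_gt0 ?exprn_gt0|rewrite mulr_ge0 ?sqr_ge0// ltW].
transitivity ((l - Q * B) ^+ 2 * A ^+ 2 * P + 2 * (l - Q * B) * A * (A * B * N ^+ 2)
  + A * B * (A * B * N ^+ 2) * Q); first by ring.
transitivity (l * ((l - Q * B) ^+ 2 * A + A * (A * B * N ^+ 2))); last by ring.
by rewrite -charl; ring.
Qed.

End SpectralNorm.

(** * Polar forms, rotations and Gram matrices of real and imaginary parts *)

Section Expi.
Variable R : realType.

Lemma expiD (a b : R) : expi (a + b) = expi a * expi b.
Proof. by rewrite /expi cosD sinD; simpc; congr (_ +i* _); ring. Qed.

Lemma sqr_modulus (z : R[i]) :
  modulus z ^+ 2 = complex.Re z ^+ 2 + complex.Im z ^+ 2.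
Proof. by case: z => x y; rewrite sqr_sqrtr// addr_ge0// sqr_ge0. Qed.

Lemma modulus_polar (r a : R) : 0 <= r -> modulus (r%:C * expi a) = r.
Proof.
move=> r0; apply/eqP; rewrite -(eqrXn2 (n := 2))// ?sqrtr_ge0//.
rewrite sqr_modulus /=; apply/eqP.
have := cos2Dsin2 a; move: (cos a) (sin a) => x y xy.
by rewrite -[RHS]mulr1 -xy; ring.
Qed.

Lemma sum_sqr_expiM (I : finType) (z : I -> R[i]) (r phi psi : R) :
  \sum_i z i ^+ 2 = r%:C * expi phi ->
  \sum_i (expi psi * z i) ^+ 2 = r%:C * expi (2 * psi + phi).
Proof.
move=> zE; under eq_bigr do rewrite exprMn.
rewrite -mulr_sumr zE [2 * _]mulr_natl mulr2n !expiD; ring.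
Qed.

Lemma sum_sqr_modulus_expiM (I : finType) (z : I -> R[i]) (psi : R) :
  \sum_i modulus (expi psi * z i) ^+ 2 = \sum_i modulus (z i) ^+ 2.
Proof.
apply: eq_bigr => i _; rewrite !sqr_modulus.
case: (z i) => x y /=; have := cos2Dsin2 psi.
move: (cos psi) (sin psi) => c s cs.
by transitivity ((c ^+ 2 + s ^+ 2) * (x ^+ 2 + y ^+ 2)); [|rewrite cs]; ring.
Qed.

(** The sum of the [z i ^+ 2] has as real part the difference of the two sums of squares and as
    imaginary part twice the mixed sum; the normalization gives the sum of the two sums of
    squares. *)
Lemma gram_Re_Im (I : finType) (z : I -> R[i]) (r phi : R) :
  \sum_i modulus (z i) ^+ 2 = 1 -> \sum_i z i ^+ 2 = r%:C * expi phi ->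
  [/\ \sum_i complex.Re (z i) ^+ 2 = (1 + r * cos phi) / 2,
      \sum_i complex.Im (z i) ^+ 2 = (1 - r * cos phi) / 2 &
      \sum_i complex.Re (z i) * complex.Im (z i) = r * sin phi / 2].
Proof.
move=> z1 zE.
have sumE : \sum_i complex.Re (z i) ^+ 2 + \sum_i complex.Im (z i) ^+ 2 = 1.
  by rewrite -big_split -z1; apply: eq_bigr => i _; rewrite sqr_modulus.
have ReE : \sum_i complex.Re (z i) ^+ 2 - \sum_i complex.Im (z i) ^+ 2 = r * cos phi.
  transitivity (complex.Re (\sum_i z i ^+ 2)); last by rewrite zE /=; ring.
  by rewrite -sumrB raddf_sum; apply: eq_bigr => i _; case: (z i) => x y /=; ring.
have ImE : 2 * (\sum_i complex.Re (z i) * complex.Im (z i)) = r * sin phi.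
  transitivity (complex.Im (\sum_i z i ^+ 2)); last by rewrite zE /=; ring.
  by rewrite mulr_sumr raddf_sum; apply: eq_bigr => i _; case: (z i) => x y /=; ring.
by split; lra.
Qed.

(** The phase may be split between [v] and [w] in any way, so [theta] is free here; it is later
    chosen to make the two parts of the rotated [w] orthogonal. *)
Lemma Theta_rank_two n (v : 'cV[R[i]]_n) (w : 'rV[R[i]]_n) (omega : R)
    (alpha beta : 'I_n -> R) (t theta : R) :
  (forall k, is_angle (alpha k) (v k 0)) ->
  (forall l, is_angle (beta l) (w 0 l)) ->
  Theta v w omega alpha beta t =
  rank_two (fun k => complex.Re (expi (omega * t + theta) * v k 0))
           (fun k => complex.Im (expi (omega * t + theta) * v k 0))
           (fun l => complex.Re (expi (- theta) * w 0 l))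
           (fun l => complex.Im (expi (- theta) * w 0 l)).
Proof.
move=> va wb; apply/matrixP => k l; rewrite !mxE.
rewrite {2 3}(va k) {2 3}(wb l) ![expi _ * _]mulrCA -!expiD /=.
rewrite (_ : omega * t + _ + _ =
  (omega * t + theta + alpha k) + (- theta + beta l)); last by ring.
by rewrite [in LHS]cosD; ring.
Qed.

End Expi.

(** * Normalized columns and rows of invertible matrices *)

Section Normalize.
Variable R : realType.

Lemma modulus_scale (k : R) (z : R[i]) : modulus (k%:C * z) ^+ 2 = k ^+ 2 * modulus z ^+ 2.
Proof. by case: z => x y; rewrite !sqr_modulus /=; ring. Qed.

Lemma sum_sqr_normalize m n (v : 'M[R[i]]_(m, n)) : v != 0 ->
  \sum_i \sum_k modulus (normalize v i k) ^+ 2 = 1.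
Proof.
move=> v0; under eq_bigr do under eq_bigr do rewrite mxE modulus_scale.
under eq_bigr do rewrite -mulr_sumr.
rewrite -mulr_sumr /cnorm2.
set S := \sum_i _.
have S_ge0 : 0 <= S by apply: sumr_ge0 => i _; apply: sumr_ge0 => k _; exact: sqr_ge0.
rewrite exprVn sqr_sqrtr// mulVf//.
apply: contra v0; rewrite psumr_eq0; last first.
  by move=> i _; apply: sumr_ge0 => k _; exact: sqr_ge0.
move=> /allP h; apply/eqP/matrixP => i k; rewrite mxE.
have := h i (mem_index_enum _); rewrite psumr_eq0; last by move=> *; exact: sqr_ge0.
move=> /allP/(_ k (mem_index_enum _)) /=; rewrite sqrf_eq0 => /eqP.
exact: ComplexField.Normc.eq0_normc.
Qed.

Lemma col_unitmx_neq0 (F : fieldType) n (V : 'M[F]_n) i :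
  V \in unitmx -> col i V != 0.
Proof.
move=> Vu; apply/eqP => /(congr1 (mulmx (invmx V))).
rewrite colE mulKmx// mulmx0 => /matrixP/(_ i 0).
by rewrite !mxE !eqxx => /eqP; rewrite oner_eq0.
Qed.

Lemma row_unitmx_neq0 (F : fieldType) n (V : 'M[F]_n) i :
  V \in unitmx -> row i V != 0.
Proof.
move=> Vu; apply/eqP => /(congr1 (mulmxr (invmx V))) /=.
rewrite rowE mulmxK// mul0mx => /matrixP/(_ 0 i).
by rewrite !mxE !eqxx => /eqP; rewrite oner_eq0.
Qed.

End Normalize.

(** * The top left singular vector and the phase of [w w^T] *)

Section TopSingularVector.
Variable R : realType.

(** This lets any positive eigenvalue of [M *m M^T] be compared with the largest singular value. *)
Lemma singular_triple_of_eigenvector m n (M : 'M[R]_(m, n)) (mu : R) (u : 'cV_m) :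
  0 < mu -> norm2 u = 1 -> M *m M^T *m u = mu *: u ->
  singular_triple M (Num.sqrt mu) u ((Num.sqrt mu)^-1 *: (M^T *m u)).
Proof.
move=> mu0 u1 uE.
have s0 : 0 < Num.sqrt mu by rewrite sqrtr_gt0.
have s2 : Num.sqrt mu ^+ 2 = mu by rewrite sqr_sqrtr// ltW.
split => //.
- rewrite norm2_scale ?invr_ge0 ?ltW// /norm2.
  rewrite (_ : \sum_i _ = mu) ?mulVf ?gt_eqF//.
  transitivity ((u^T *m (M *m M^T *m u)) 0 0).
    rewrite -mulmxA mulmxA -[M in _ *m M *m _]trmxK -trmx_mul !mxE.
    by apply: eq_bigr => i _; rewrite !mxE.
  rewrite uE -scalemxAr mxE; transitivity (mu * \sum_i u i 0 ^+ 2).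
    by congr (_ * _); rewrite !mxE; apply: eq_bigr => i _; rewrite mxE.
  by move/norm2_eq1: u1 => ->; rewrite mulr1.
- rewrite -scalemxAr mulmxA uE scalerA; congr (_ *: _).
  by rewrite -{2}s2 expr2 mulKf// gt_eqF.
- by rewrite scalerA divff ?scale1r// gt_eqF.
Qed.

(* The Gram matrix [G] of the real and imaginary parts of [w] acts on the plane,
   identified with the complex numbers, by [G z = (|w|^2 z + (w w^T) conj z) / 2]. *)
Lemma sum_sqr_top_left_singular n (w : 'rV[R[i]]_n) (u : 'cV[R]_2) (theta : R) :
  \sum_l modulus (w 0 l) ^+ 2 = 1 ->
  top_left_singular_vector (re_im_rows w) u ->
  is_angle theta (u 0 0 +i* u 1 0) ->
  \sum_l w 0 l ^+ 2 = (modulus (\sum_l w 0 l ^+ 2))%:C * expi (2 * theta).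
Proof.
move=> w1 [s [x [[s0 u1 x1 Mx Mu] smax]]] uth.
set M := re_im_rows w in Mx Mu smax.
pose A := \sum_l complex.Re (w 0 l) ^+ 2.
pose B := \sum_l complex.Im (w 0 l) ^+ 2.
pose N := \sum_l complex.Re (w 0 l) * complex.Im (w 0 l).
have AB : A + B = 1.
  by rewrite -big_split -w1; apply: eq_bigr => l _; rewrite sqr_modulus.
have G i k : (M *m M^T) i k = if i == 0 then (if k == 0 then A else N)
                              else (if k == 0 then N else B).
  rewrite mxE; case: ifP => i0; case: ifP => k0; apply: eq_bigr => l _;
  by rewrite !mxE i0 k0 ?expr2// mulrC.
have Gy (y : 'cV_2) : (M *m M^T *m y) 0 0 = A * y 0 0 + N * y 1 0 /\
    (M *m M^T *m y) 1 0 = N * y 0 0 + B * y 1 0.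
  by split; rewrite [LHS]mxE !big_ord_recl big_ord0 addr0 !G /=;
    rewrite (_ : lift ord0 ord0 = 1)//; apply/val_inj.
have uE : [/\ u 0 0 = cos theta & u 1 0 = sin theta].
  have mu1 : modulus (u 0 0 +i* u 1 0) = 1.
    move/norm2_eq1: u1; rewrite !big_ord_recl big_ord0 addr0.
    rewrite (_ : lift ord0 ord0 = 1); last exact/val_inj.
    by move=> h; rewrite /modulus /= h sqrtr1.
  by move: uth; rewrite /is_angle mu1 mul1r => -[-> ->].
case: uE => uc us; set cc := cos theta in uc; set ss := sin theta in us.
have cs : cc ^+ 2 + ss ^+ 2 = 1 by exact: cos2Dsin2.
have Gu : M *m M^T *m u = s ^+ 2 *: u.
  by rewrite -mulmxA Mu -scalemxAr Mx scalerA.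
have [E1 E2] := Gy u.
rewrite Gu !mxE uc us in E1 E2.
(* The Gram matrix has trace [A + B = 1], so its other eigenvalue is [1 - s ^+ 2], with [u] turned
   by a right angle as eigenvector. If it is positive, maximality of [s] bounds it by [s ^+ 2];
   otherwise the claim is immediate. *)
have s2 : 0 <= 2 * s ^+ 2 - 1.
  have [|sp] := leP (1 - s ^+ 2) 0; first by lra.
  pose u' : 'cV[R]_2 := \col_i if i == 0 then - ss else cc.
  have u'1 : norm2 u' = 1.
    apply/norm2_eq1; rewrite !big_ord_recl big_ord0 addr0 !mxE /=.
    by rewrite sqrrN addrC.
  have Gu' : M *m M^T *m u' = (1 - s ^+ 2) *: u'.
    have [E1' E2'] := Gy u'.
    apply/matrixP => i k; rewrite (ord1 k).
    have [->|->] : i = 0 \/ i = 1.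
    - by case: i => -[|[|]]// ?; [left|right]; apply/val_inj.
    - rewrite E1' !mxE /=.
      transitivity (- ((A + B) * ss) + (N * cc + B * ss)); first by ring.
      by rewrite AB -E2; ring.
    - rewrite E2' !mxE /=.
      transitivity ((A + B) * cc - (A * cc + N * ss)); first by ring.
      by rewrite AB -E1; ring.
  have le_s := smax _ _ _ (singular_triple_of_eigenvector sp u'1 Gu').
  have : Num.sqrt (1 - s ^+ 2) ^+ 2 <= s ^+ 2 by rewrite lerXn2r ?nnegrE ?sqrtr_ge0.
  rewrite sqr_sqrtr ?(ltW sp)//; lra.
have kE : \sum_l w 0 l ^+ 2 = (2 * s ^+ 2 - 1)%:C * expi (2 * theta).
  have -> : \sum_l w 0 l ^+ 2 = (A - B) +i* (2 * N).
    apply/eqP; rewrite eq_complex; apply/andP; split; apply/eqP.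
      by rewrite raddf_sum /= -sumrB; apply: eq_bigr => l _; case: (w 0 l) => a b /=; ring.
    by rewrite raddf_sum /= mulr_sumr; apply: eq_bigr => l _; case: (w 0 l) => a b /=; ring.
  (* The factor [cc ^+ 2 + ss ^+ 2 = 1] is inserted so that the eigenvector equations [E1] and [E2]
     can be substituted. *)
  have ReE : A - B = (2 * s ^+ 2 - 1) * (cc * cc - ss * ss).
    transitivity ((A - B) * (cc ^+ 2 + ss ^+ 2)); first by rewrite cs mulr1.
    transitivity (2 * cc * (s ^+ 2 * cc) - 2 * ss * (s ^+ 2 * ss)
      - (A + B) * (cc ^+ 2 - ss ^+ 2)); first by rewrite E1 E2; ring.
    by rewrite AB; ring.
  have ImE : 2 * N = (2 * s ^+ 2 - 1) * (2 * cc * ss).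
    transitivity (2 * N * (cc ^+ 2 + ss ^+ 2)); first by rewrite cs mulr1.
    transitivity (2 * ss * (s ^+ 2 * cc) + 2 * cc * (s ^+ 2 * ss)
      - 2 * (A + B) * cc * ss); first by rewrite E1 E2; ring.
    by rewrite AB; ring.
  rewrite [2 * theta]mulr_natl mulr2n expiD ReE ImE /expi -/cc -/ss; simpc.
  by congr (_ +i* _); ring.
(* By [s2] the real factor is nonnegative, hence it is the modulus. *)
by rewrite {1}kE kE modulus_polar.
Qed.

End TopSingularVector.

(** * The squared norm as a function of the cosine of the phase *)

Section TopEigenvalue.
Variable R : realType.

(* The larger root of [l^2 - (1 + V W C) / 2 l + (1 - V^2) (1 - W^2) / 16], where
   [C] stands for the cosine of [Omega]. *)
Definition top_root (V W C : R) : R :=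
  ((1 + V * W * C) / 2 +
   Num.sqrt (((1 + V * W * C) / 2) ^+ 2 - (1 - V ^+ 2) * (1 - W ^+ 2) / 4)) / 2.

(** Only the sum of the roots depends on [C]; it grows with [C] and stays nonnegative because
    [V * W <= 1], so its square grows too. *)
Lemma top_root_mono (V W C D : R) :
  0 <= V <= 1 -> 0 <= W <= 1 -> -1 <= C -> C <= D -> top_root V W C <= top_root V W D.
Proof.
move=> /andP[V0 V1] /andP[W0 W1] C1 CD.
have VW0 : 0 <= V * W by rewrite mulr_ge0.
have VW1 : V * W <= 1 by rewrite mulr_ile1.
have TC : 0 <= (1 + V * W * C) / 2 by nra.
have TCD : (1 + V * W * C) / 2 <= (1 + V * W * D) / 2 by nra.
rewrite /top_root ler_pM2r ?invr_gt0 ?ltr0n//.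
apply: lerD => //; apply: ler_wsqrtr; apply: lerB => //.
by rewrite lerXn2r// nnegrE// (le_trans TC).
Qed.

Lemma top_root1 (V W : R) : 0 <= V -> 0 <= W ->
  top_root V W 1 = (1 + V) * (1 + W) / 4.
Proof.
move=> V0 W0; rewrite /top_root.
rewrite (_ : _ - _ = ((V + W) / 2) ^+ 2); last by field.
by rewrite sqrtr_sqr ger0_norm ?divr_ge0 ?addr_ge0//; field.
Qed.

(** The discriminant is the square of [(W - V) / 2]; the sign of [W - V] produces the two cases of
    [amin]. *)
Lemma top_rootN1 (V W : R) : top_root V W (-1) = amin V W / 4.
Proof.
rewrite /top_root (_ : _ - _ = ((W - V) / 2) ^+ 2); last by field.
rewrite sqrtr_sqr normrM [`|2^-1|]ger0_norm ?invr_ge0// /amin.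
have [VW|VW] := leP V W; first by rewrite ger0_norm ?subr_ge0//; field.
by rewrite ltr0_norm ?subr_lt0//; field.
Qed.

(** These are the hypotheses of [spectral_norm_rank_two]. Since [PA + QB = (1 + V * W * C) / 2], the
    root is [(PA + QB + r) / 2], where [r ^+ 2] exceeds [(PA - QB) ^+ 2] by four times the
    right-hand side of the equation. *)
Lemma top_rootP (V W C S : R) : C ^+ 2 + S ^+ 2 = 1 -> W ^+ 2 <= 1 ->
  let l := top_root V W C in
  let PA := (1 + V * C) / 2 * ((1 + W) / 2) in
  let QB := (1 - V * C) / 2 * ((1 - W) / 2) in
  [/\ PA <= l, QB <= l &
    (l - PA) * (l - QB) = (1 + W) / 2 * ((1 - W) / 2) * (V * S / 2) ^+ 2].
Proof.
move=> CS W1 l PA QB.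
pose N2 := (1 + W) / 2 * ((1 - W) / 2) * (V * S / 2) ^+ 2.
have N0 : 0 <= N2 by rewrite mulr_ge0 ?sqr_ge0//; nra.
have discE : ((1 + V * W * C) / 2) ^+ 2 - (1 - V ^+ 2) * (1 - W ^+ 2) / 4 =
    (PA - QB) ^+ 2 + 4 * N2.
  have S2 : S ^+ 2 = 1 - C ^+ 2 by lra.
  by rewrite /N2 !exprMn S2 /PA /QB; field.
set r := Num.sqrt ((PA - QB) ^+ 2 + 4 * N2).
have r2 : r ^+ 2 = (PA - QB) ^+ 2 + 4 * N2.
  by rewrite sqr_sqrtr// addr_ge0 ?sqr_ge0// mulr_ge0.
have r0 : 0 <= r by exact: sqrtr_ge0.
have rPQ : `|PA - QB| <= r.
  rewrite -sqrtr_sqr; apply: ler_wsqrtr; lra.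
have lE : l = (PA + QB + r) / 2 by rewrite /l /top_root discE -/r /PA /QB; field.
move: rPQ; rewrite ler_norml => /andP[rPQ1 rPQ2].
split; rewrite ?lE; [lra..|].
rewrite -/N2 (_ : _ * _ = (r ^+ 2 - (PA - QB) ^+ 2) / 4); last by field.
by rewrite r2; field.
Qed.

End TopEigenvalue.

(** * Monotone oscillation of functions of a cosine *)

Section Oscillation.
Variable R : realType.

Lemma cos_period (x : R) (k : int) : cos (x + (2 * k)%:~R * pi) = cos x.
Proof.
have nat_case (y : R) (m : nat) : cos (y + (2 * m%:Z)%:~R * pi) = cos y.
  have := alternatingn (@cosDpi R) (m * 2) y.
  rewrite mulnC exprM sqrrN expr1n expr1n mul1r mulnC => <-.
  by congr (cos (_ + _)); rewrite intrM -[_ *+ (m * 2)]mulr_natl natrM; ring.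
have [[m ->]|[m ->]] : (exists m : nat, k = m) \/ (exists m : nat, k = - m%:Z).
- by case: k => m; [left; exists m|right; exists m.+1].
- exact: nat_case.
(* For negative [k], adding [m] periods undoes the shift. *)
rewrite -[LHS](nat_case _ m); congr cos.
by rewrite mulrN intrN; ring.
Qed.

Lemma cos_even_multiple (x : R) : even_multiple_pi x -> cos x = 1.
Proof. by case=> k ->; rewrite -[_ * _]add0r cos_period cos0. Qed.

Lemma cos_odd_multiple (x : R) : odd_multiple_pi x -> cos x = -1.
Proof.
by case=> k ->; rewrite intrD mulrDl mul1r addrC cos_period cospi.
Qed.

Lemma multiple_pi (x : R) :
  even_multiple_pi x \/ odd_multiple_pi x <-> exists k : int, x = k%:~R * pi.
Proof.
split=> [[[k ->]|[k ->]]|[k ->]]; [by eexists|by eexists|].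
have := divz_eq k 2; have := modz_ge0 k (isT : (2 : int) != 0).
have := ltz_pmod k (isT : 0 < (2 : int)).
case: (k %% 2)%Z => [[|[|]]|]// _ _ kE; [left|right]; exists (k %/ 2)%Z;
  by congr (_%:~R * pi); rewrite {1}kE [_ * 2]mulrC ?addr0.
Qed.

Lemma cos_decreasing_0pi (x y : R) : 0 <= x -> x <= y -> y <= pi -> cos y <= cos x.
Proof.
move=> x0 xy ypi.
have xI : x \in `[0, pi] by rewrite in_itv/= x0 (le_trans xy).
have yI : y \in `[0, pi] by rewrite in_itv/= ypi (le_trans x0).
by rewrite leNgt ltr_cos// -leNgt.
Qed.

Lemma oscillates_comp_cos (g Omega f : R -> R) (s c : R) :
  0 < s -> (forall t, Omega t = s * t + c) ->
  (forall x y, -1 <= x -> x <= y -> y <= 1 -> g x <= g y) ->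
  (forall t, f t = g (cos (Omega t))) ->
  (forall t, f (t + 2 * pi / s) = f t) /\
  is_maximum f (g 1) /\
  is_minimum f (g (-1)) /\
  (forall t, even_multiple_pi (Omega t) -> f t = g 1) /\
  (forall t, odd_multiple_pi (Omega t) -> f t = g (-1)) /\
  oscillates_monotonically f (g 1) (g (-1))
    [set t | even_multiple_pi (Omega t) \/ odd_multiple_pi (Omega t)].
Proof.
move=> s0 OE g_mono fE.
have s_neq0 : s != 0 by rewrite gt_eqF.
have Oinv y : Omega ((y - c) / s) = y by rewrite OE; field.
have Ole t t' : (Omega t <= Omega t') = (t <= t').
  by rewrite !OE lerD2r ler_pM2l.
have f_even t : even_multiple_pi (Omega t) -> f t = g 1.
  by move=> /cos_even_multiple h; rewrite fE h.
have f_odd t : odd_multiple_pi (Omega t) -> f t = g (-1).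
  by move=> /cos_odd_multiple h; rewrite fE h.
split; [|split; [|split; [|split; [|split]]]] => //.
- move=> t; rewrite !fE; congr g; rewrite -[RHS](cos_period _ 1).
  by congr cos; rewrite !OE mulr1; field.
- split; first by exists ((0 - c) / s); apply: f_even; rewrite Oinv; exists 0; rewrite mulr0 mul0r.
  by move=> t; rewrite fE; apply: g_mono; rewrite ?cos_geN1 ?cos_le1.
- split; first by exists ((pi - c) / s); apply: f_odd; rewrite Oinv; exists 0; rewrite mulr0 add0r mul1r.
  by move=> t; rewrite fE; apply: g_mono; rewrite ?cos_geN1 ?cos_le1.
move=> a b [ab /= Ea Eb gap].
have pi0 := pi_gt0 R.
have [k OaE] := (multiple_pi (Omega a)).1 Ea.
have [l ObE] := (multiple_pi (Omega b)).1 Eb.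
have {l ObE} ObE : Omega b = Omega a + pi.
  (* Consecutive listed points are exactly [pi] apart in phase: with a larger gap, [Omega a + pi]
     would be the phase of a listed point strictly between them. *)
  have kl : k < l.
    have : Omega a < Omega b by rewrite !OE ltrD2r ltr_pM2l.
    by rewrite OaE ObE ltr_pM2r// ltr_int.
  have pikl : Omega a + pi <= Omega b.
    rewrite OaE ObE -[X in _ + X]mul1r -mulrDl ler_pM2r//.
    by rewrite -[1]/(1%:~R) -intrD ler_int lezD1.
  apply/eqP; rewrite eq_le pikl andbT leNgt; apply/negP => lt_b.
  apply: (gap ((Omega a + pi - c) / s)).
  - by rewrite ltNge -Ole -ltNge Oinv ltrDl.
  - by rewrite ltNge -Ole -ltNge Oinv.
  - apply/multiple_pi; exists (k + 1); rewrite Oinv OaE intrD; ring.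
case: Ea => [ea|oa]; [left|right].
  have [m mE] := ea.
  (* Removing the even multiple [Omega a] moves the phase interval to [[0, pi]], where the cosine
     decreases. *)
  have cosE t : cos (Omega t) = cos (Omega t - Omega a).
    by rewrite -[RHS](cos_period _ m) -mE subrK.
  split; first exact: f_even.
    by apply: f_odd; rewrite ObE mE; exists m; rewrite intrD; ring.
  move=> t t' at_ tt' t'b; rewrite !fE !cosE.
  apply: g_mono; rewrite ?cos_geN1 ?cos_le1//; apply: cos_decreasing_0pi.
  - by rewrite subr_ge0 Ole.
  - by rewrite lerD2r Ole.
  - by rewrite lerBlDl -ObE Ole.
have [m mE] := oa.
(* Removing an odd multiple of [pi] flips the sign, hence the direction of monotonicity. *)
have cosE t : cos (Omega t) = - cos (Omega t - Omega a).
  rewrite -cosDpi -[RHS](cos_period _ m); congr cos.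
  by rewrite {1}mE intrD; ring.
split; first exact: f_odd.
  apply: f_even; rewrite ObE mE; exists (m + 1).
  by rewrite (_ : 2 * (m + 1) = 2 * m + 1 + 1) ?[in RHS]intrD; ring.
move=> t t' at_ tt' t'b; rewrite !fE !cosE.
apply: g_mono.
- by rewrite lerN2 cos_le1.
- rewrite lerN2; apply: cos_decreasing_0pi.
  + by rewrite subr_ge0 Ole.
  + by rewrite lerD2r Ole.
  + by rewrite lerBlDl -ObE Ole.
- by rewrite -[1]opprK lerN2 cos_geN1.
Qed.

End Oscillation.

(** * Extreme values and oscillation of the norm of [Theta] *)

Theorem theorem16 (R : realType) (n : nat) (A : 'M[R]_n)
  (q : nat) (r : 'I_q -> R) (hr : spectral_real_parts A r)
  (j : 'I_q) (lambda : R[i]) (hj : single_complex A (r j) lambda)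
  (V : 'M[R[i]]_n) (cs : seq (chain R n)) (hV : jordan_basis A V cs)
  (c c' : chain R n)
  (hc : longest_chain cs lambda c) (hc' : longest_chain cs (conjc lambda) c')
  (hcc' : conjugate_chains V c c')
  (v : 'cV[R[i]]_n) (hv : v = normalize (col (chain_first c) V))
  (w : 'rV[R[i]]_n) (hw : w = normalize (row (chain_last c) (invmx V)))
  (omega : R) (homega : omega = complex.Im lambda)
  (alpha : 'I_n -> R) (halpha : forall k, is_angle (alpha k) (v k 0))
  (beta : 'I_n -> R) (hbeta : forall l, is_angle (beta l) (w 0 l))
  (Vj delta : R) (hVj : 0 <= Vj)
  (hdelta : (v^T *m v) 0 0 = Vj%:C * expi delta)
  (Wj : R) (hWj : Wj = modulus ((w *m w^T) 0 0))
  (u : 'cV[R]_2) (hu : top_left_singular_vector (re_im_rows w) u)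
  (theta : R) (htheta : is_angle theta (u 0 0 +i* u 1 0)) :
  let f := fun t => spectral_norm (Theta v w omega alpha beta t) in
  let Omega := fun t => 2 * (omega * t + theta) + delta in
  let fmax := Num.sqrt ((1 + Vj) * (1 + Wj) / 4) in
  let fmin := Num.sqrt (amin Vj Wj / 4) in
  (forall t, f (t + pi / omega) = f t) /\
  is_maximum f fmax /\
  is_minimum f fmin /\
  (forall t, even_multiple_pi (Omega t) -> f t = fmax) /\
  (forall t, odd_multiple_pi (Omega t) -> f t = fmin) /\
  oscillates_monotonically f fmax fmin
    [set t | even_multiple_pi (Omega t) \/ odd_multiple_pi (Omega t)].
Proof.
move=> f Omega fmax fmin.
have [Vu _ _] := hV.
have omega0 : 0 < omega by rewrite homega; case: hj.
have v1 : \sum_k modulus (v k 0) ^+ 2 = 1.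
  rewrite -(sum_sqr_normalize (col_unitmx_neq0 (chain_first c) Vu)) -hv.
  by apply: eq_bigr => k _; rewrite big_ord1.
have w1 : \sum_l modulus (w 0 l) ^+ 2 = 1.
  have Wu : invmx V \in unitmx by rewrite unitmx_inv.
  by rewrite -(sum_sqr_normalize (row_unitmx_neq0 (chain_last c) Wu)) -hw big_ord1.
have vE : \sum_k v k 0 ^+ 2 = Vj%:C * expi delta.
  by rewrite -hdelta mxE; apply: eq_bigr => k _; rewrite mxE.
have wE : \sum_l w 0 l ^+ 2 = Wj%:C * expi (2 * theta).
  have wwE : (w *m w^T) 0 0 = \sum_l w 0 l ^+ 2.
    by rewrite mxE; apply: eq_bigr => l _; rewrite mxE.
  by rewrite hWj wwE; apply: sum_sqr_top_left_singular hu htheta.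
have Wj0 : 0 <= Wj by rewrite hWj /modulus; case: (_ 0 0) => x y; exact: sqrtr_ge0.
(* Rotation by [- theta] cancels the phase [2 * theta] of [w w^T], so the mixed sum [ab] becomes
   zero. *)
have [a2 b2 ab] := gram_Re_Im
  (etrans (sum_sqr_modulus_expiM _ (- theta)) w1) (sum_sqr_expiM (- theta) wE).
rewrite mulrN addNr cos0 sin0 mulr1 in a2 b2 ab.
have gram_v psi := gram_Re_Im
  (etrans (sum_sqr_modulus_expiM _ psi) v1) (sum_sqr_expiM psi vE).
have Wj1 : Wj <= 1.
  suff : 0 <= (1 - Wj) / 2 by lra.
  by rewrite -b2; apply: sumr_ge0 => l _; exact: sqr_ge0.
have Vj1 : Vj <= 1.
  suff : 0 <= (1 - Vj) / 2 by lra.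
  (* This rotation cancels the phase [delta], so [(1 - Vj) / 2] is a sum of squares. *)
  have [_ q2 _] := gram_v (- (delta / 2)).
  have phase0 : 2 * - (delta / 2) + delta = 0 by field.
  rewrite phase0 cos0 mulr1 in q2.
  by rewrite -q2; apply: sumr_ge0 => l _; exact: sqr_ge0.
have fE t : f t = Num.sqrt (top_root Vj Wj (cos (Omega t))).
  (* Doubling this angle and adding [delta] gives exactly [Omega t]. *)
  have [p2 q2 pq] := gram_v (omega * t + theta).
  have W2 : Wj ^+ 2 <= 1 by rewrite expr_le1.
  have [PAl QBl charl] := top_rootP Vj (cos2Dsin2 (Omega t)) W2.
  rewrite /f (Theta_rank_two omega t theta halpha hbeta).
  apply: spectral_norm_rank_two; rewrite ?a2 ?b2 ?ab ?p2 ?q2 ?pq //.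
  - by rewrite mulr0 mul0r.
  - by rewrite divr_gt0// ltr_wpDr.
have g_mono x y : -1 <= x -> x <= y -> y <= 1 ->
    Num.sqrt (top_root Vj Wj x) <= Num.sqrt (top_root Vj Wj y).
  by move=> x1 xy _; rewrite ler_wsqrtr// top_root_mono ?hVj ?Wj0.
have OmegaE t : Omega t = 2 * omega * t + (2 * theta + delta).
  by rewrite /Omega; ring.
have omega2 : 0 < 2 * omega by rewrite mulr_gt0.
have := oscillates_comp_cos omega2 OmegaE g_mono fE.
rewrite top_root1// top_rootN1 => -[per rest]; split => // t.
(* The phase has slope [2 * omega], so the period [2 * pi / (2 * omega)] is [pi / omega]. *)
by rewrite -[RHS]per; congr (f (_ + _)); field; rewrite gt_eqF.
Qed.
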